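(* For every choice of $I=I_1+\epsilon I_2$, $J=J_1+\epsilon J_2\in\mathbb{S}_\mathbb{DH}$, the following properties hold true. 1. $\mathbb{DC}_J$ is a $\ast$-subalgebra of $\mathbb{DH}$, isomorphic to the commutative $\ast$-algebra $\mathbb{DR}_\mathbb{C}$. In particular this is true for $\mathbb{DC}_i$, which is the $\ast$-algebra of dual complex numbers $\mathbb{DC}=\mathbb{C}+\epsilon\mathbb{C}$. 2. If $I=\pm J$, then $\mathbb{DC}_I=\mathbb{DC}_J$. If $I\neq\pm J$ but $I_1=\pm J_1$, then $\mathbb{DR}\subset\mathbb{DC}_I\cap\mathbb{DC}_J=\operatorname{span}(1,\epsilon,\epsilon I_1)\subset\mathbb{R}+\epsilon\mathbb{H}$. If $I_1\neq\pm J_1$, then $\mathbb{DR}=\mathbb{DC}_I\cap\mathbb{DC}_J\subset\mathbb{R}+\epsilon\mathbb{H}$. Finally, $\mathbb{DC}_I^+\cap\mathbb{DC}_J^+=\emptyset$ if $I\neq J$. 3. $\mathbb{DH}=\bigcup_{J\in\mathbb{S}_\mathbb{DH}}\mathbb{DC}_J$ and the map $\Phi:\mathbb{S}_\mathbb{DH}\times\mathbb{DR}_\mathbb{C}\to\mathbb{DH}$, $(J,a+e_1b)\mapsto a+Jb$ is surjective. So is the restriction $\Phi:\mathbb{S}_\mathbb{DH}\times\mathbb{R}_\mathbb{C}\to Q_\mathbb{DH}$. Moreover, for all $J\in\mathbb{S}_\mathbb{DH}$ and all $a\in\mathbb{DR}$ the following equalities hold true: $$\Phi^{-1}(a+Jb)=\{(J,a+e_1b),(-J,a-e_1b)\}\quad\text{for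 all } b=b_1+\epsilon b_2\in\mathbb{DR}\text{ with } b_1>0,$$ $$\Phi^{-1}(a+J\epsilon b_2)=(T_{J_1}\times\{a+e_1\epsilon b_2\})\cup(T_{-J_1}\times\{a-e_1\epsilon b_2\})\quad\text{for all } b_2\in\mathbb{R}\setminus\{0\},$$ $$\Phi^{-1}(a)=\mathbb{S}_\mathbb{DH}\times\{a\}.$$ As a consequence, the following restrictions are homeomorphisms: $$\Phi:\mathbb{S}_\mathbb{DH}\times\mathbb{DR}_\mathbb{C}^+\to\bigcup_{J\in\mathbb{S}_\mathbb{DH}}\mathbb{DC}_J^+=\mathbb{DH}\setminus(\mathbb{R}+\epsilon\mathbb{H}),\qquad \Phi:\mathbb{S}_\mathbb{DH}\times\mathbb{R}_\mathbb{C}^+\to\bigcup_{J\in\mathbb{S}_\mathbb{DH}}\mathbb{C}_J^+=Q_\mathbb{DH}\setminus\mathbb{R}.$$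
   Context: $\mathbb{H}$ is the algebra of quaternions with conjugation $x\mapsto x^c$. $\mathbb{DH}=\mathbb{H}+\epsilon\mathbb{H}$ is the algebra of dual quaternions, with $\epsilon$ central and $\epsilon^2=0$, involution $(x_1+\epsilon x_2)^c=x_1^c+\epsilon x_2^c$ and the topology of $\mathbb{R}^8$. $\mathbb{DR}=\mathbb{R}+\epsilon\mathbb{R}$. $\mathbb{S}_\mathbb{H}=\{J\in\mathbb{H}:J^2=-1\}$ and $\mathbb{S}_\mathbb{DH}=\{J\in\mathbb{DH}:J+J^c=0,\ JJ^c=1\}=\{J_1+\epsilon J_2:J_1\in\mathbb{S}_\mathbb{H},J_2\in\operatorname{Im}(\mathbb{H}),J_1\perp J_2\}$. The quadratic cone is $Q_\mathbb{DH}=\bigcup_{J\in\mathbb{S}_\mathbb{DH}}\mathbb{C}_J$ with $\mathbb{C}_J=\operatorname{span}(1,J)$ (real span). For $J_1\in\mathbb{S}_\mathbb{H}$, $T_{J_1}=J_1+\epsilon\{x_2\in\operatorname{Im}(\mathbb{H}):x_2\perp J_1\}$. $\mathbb{R}_\mathbb{C}=\{a_1+e_1b_1:a_1,b_1\in\mathbb{R}\}$ and $\mathbb{DR}_\mathbb{C}=\{a+e_1b:a,b\in\mathbb{DR}\}$ with $e_1$ central, $e_1^2=-1$; the involution giving $\mathbb{DR}_\mathbb{C}$ its $\ast$-algebra structure in this statement is $\overline{a+e_1b}=a-e_1b$. $\mathbb{R}_\mathbb{C}^+=\{a_1+e_1b_1: a_1,b_1\in\mathbb{R},b_1>0\}$,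 $\mathbb{DR}_\mathbb{C}^+=\mathbb{R}_\mathbb{C}^++\epsilon\mathbb{R}_\mathbb{C}$. For $J\in\mathbb{S}_\mathbb{DH}$, $\phi_J(a+e_1b)=a+Jb$, and $\mathbb{DC}_J=\phi_J(\mathbb{DR}_\mathbb{C})=\operatorname{span}(1,J,\epsilon,\epsilon J_1)$ (real span; note $\epsilon J=\epsilon J_1$), $\mathbb{DC}_J^+=\phi_J(\mathbb{DR}_\mathbb{C}^+)$, $\mathbb{C}_J^+=\phi_J(\mathbb{R}_\mathbb{C}^+)$. $\mathbb{C}$ is identified with $\mathbb{C}_i=\operatorname{span}(1,i)$. *)

(* Defs.v *)
From HB Require Import structures.
From mathcomp Require Import all_boot all_order all_algebra.
From mathcomp Require Import all_classical all_reals all_analysis.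
From mathcomp Require Import ring.
Set Implicit Arguments.
Unset Strict Implicit.
Unset Printing Implicit Defensive.
Import Order.TTheory GRing.Theory Num.Theory.
Import numFieldNormedType.Exports.
Local Open Scope classical_set_scope.
Local Open Scope ring_scope.

Definition star_involution (R : pzRingType) (A : algType R) (c : A -> A) :=
  [/\ linear c, involutive c & forall x y, c (x * y) = c y * c x].

Definition star_subalgebra (R : pzRingType) (A : algType R) (c : A -> A)
    (S : set A) :=
  GRing.subalg_closed (mem S) /\ (forall x, S x -> S (c x)).

(* S, with the operations and involution of B, is *-isomorphic to A *)
Definition star_isomorphic_to_sub (R : pzRingType) (A B : algType R)
    (cA : A -> A) (cB : B -> B) (S : set B) :=
  exists f : {lrmorphism A -> B},
    [/\ injective f, range f = S & forall z, f (cA z) = cB (f z)].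

Definition rspan (R : pzRingType) (V : lmodType R) (s : seq V) : set V :=
  [set x | exists k : 'I_(size s) -> R, x = \sum_i k i *: s`_i].

(* f restricts to a homeomorphism from A onto B, both with the subspace
   topology *)
Definition homeomorphism_on (X Y : topologicalType) (A : set X) (B : set Y)
    (f : X -> Y) :=
  [/\ set_bij A B f, {within A, continuous f} &
      exists2 g : Y -> X, {in A, cancel f g} & {within B, continuous g}].

(* [quat], [dual] and [cplx] are records rather than aliases of products, so
   that the componentwise ring structure of a product is never inferred on
   them; their topology is transported from the product topology. *)

Record quat (R : Type) := Quat { q0 : R; q1 : R; q2 : R; q3 : R }.

Definition tuple_of_quat (R : Type) (x : quat R) := (q0 x, q1 x, q2 x, q3 x).
Definition quat_of_tuple (R : Type) (x : R * R * R * R) :=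
  Quat x.1.1.1 x.1.1.2 x.1.2 x.2.
Lemma tuple_of_quatK (R : Type) :
  cancel (@tuple_of_quat R) (@quat_of_tuple R).
Proof. by case. Qed.

HB.instance Definition _ (R : choiceType) :=
  Choice.copy (quat R) (can_type (@tuple_of_quatK R)).
HB.instance Definition _ (R : topologicalType) :=
  Topological.copy (quat R) (initial_topology (@tuple_of_quat R)).

Section Quaternions.
Context (R : comNzRingType).
Implicit Types x y : quat R.

Definition qadd x y :=
  Quat (q0 x + q0 y) (q1 x + q1 y) (q2 x + q2 y) (q3 x + q3 y).
Definition qopp x := Quat (- q0 x) (- q1 x) (- q2 x) (- q3 x).
Definition qscale (k : R) x := Quat (k * q0 x) (k * q1 x) (k * q2 x) (k * q3 x).
Definition qmul x y :=
  Quat (q0 x * q0 y - q1 x * q1 y - q2 x * q2 y - q3 x * q3 y)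
       (q0 x * q1 y + q1 x * q0 y + q2 x * q3 y - q3 x * q2 y)
       (q0 x * q2 y - q1 x * q3 y + q2 x * q0 y + q3 x * q1 y)
       (q0 x * q3 y + q1 x * q2 y - q2 x * q1 y + q3 x * q0 y).

Let qaddA : associative qadd.
Proof. by move=> x y z; congr Quat; rewrite /=; ring. Qed.
Let qaddC : commutative qadd.
Proof. by move=> x y; congr Quat; ring. Qed.
Let qadd0x : left_id (Quat 0 0 0 0) qadd.
Proof. by case=> a b c d; congr Quat; rewrite /=; ring. Qed.
Let qaddNx : left_inverse (Quat 0 0 0 0) qopp qadd.
Proof. by move=> x; congr Quat; rewrite /=; ring. Qed.

HB.instance Definition _ :=
  GRing.isZmodule.Build (quat R) qaddA qaddC qadd0x qaddNx.

Let qscaleA a b x : qscale a (qscale b x) = qscale (a * b) x.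
Proof. by congr Quat; rewrite /=; ring. Qed.
Let qscale1x : left_id 1 qscale.
Proof. by case=> a b c d; congr Quat; rewrite /=; ring. Qed.
Let qscaleDr : right_distributive qscale +%R.
Proof. by move=> k x y; congr Quat; rewrite /=; ring. Qed.
Let qscaleDl x : {morph qscale^~ x : a b / a + b}.
Proof. by move=> a b; congr Quat; rewrite /=; ring. Qed.

HB.instance Definition _ := GRing.Zmodule_isLmodule.Build R (quat R)
  qscaleA qscale1x qscaleDr qscaleDl.

Let qmulA : associative qmul.
Proof. by move=> x y z; congr Quat; rewrite /=; ring. Qed.
Let qmul1x : left_id (Quat 1 0 0 0) qmul.
Proof. by case=> a b c d; congr Quat; rewrite /=; ring. Qed.
Let qmulx1 : right_id (Quat 1 0 0 0) qmul.
Proof. by case=> a b c d; congr Quat; rewrite /=; ring. Qed.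
Let qmulDl : left_distributive qmul +%R.
Proof. by move=> x y z; congr Quat; rewrite /=; ring. Qed.
Let qmulDr : right_distributive qmul +%R.
Proof. by move=> x y z; congr Quat; rewrite /=; ring. Qed.
Let quat1_neq0 : Quat 1 0 0 0 != 0 :> quat R.
Proof. by apply/eqP => -[/eqP]; rewrite oner_eq0. Qed.

HB.instance Definition _ := GRing.Zmodule_isNzRing.Build (quat R)
  qmulA qmul1x qmulx1 qmulDl qmulDr quat1_neq0.

Let quat_scalerAl (k : R) x y : k *: (x * y) = k *: x * y.
Proof. by congr Quat; rewrite /=; ring. Qed.

HB.instance Definition _ :=
  GRing.Lmodule_isLalgebra.Build R (quat R) quat_scalerAl.

Let quat_scalerAr (k : R) x y : k *: (x * y) = x * (k *: y).
Proof. by congr Quat; rewrite /=; ring. Qed.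

HB.instance Definition _ :=
  GRing.Lalgebra_isAlgebra.Build R (quat R) quat_scalerAr.

Definition qconj x := Quat (q0 x) (- q1 x) (- q2 x) (- q3 x).
Definition qi : quat R := Quat 0 1 0 0.
Definition ImH : set (quat R) := [set x | q0 x = 0].
Definition qdot x y : R :=
  q0 x * q0 y + q1 x * q1 y + q2 x * q2 y + q3 x * q3 y.

Lemma qconj_star : star_involution qconj.
Proof.
split=> [k x y|[a b c d]|x y]; congr Quat; rewrite /= ?opprK //; ring.
Qed.

End Quaternions.

(* [Dual x1 x2] is x1 + epsilon x2, with epsilon central of square zero *)
Record dual (A : Type) := Dual { dpart1 : A; dpart2 : A }.

Definition pair_of_dual (A : Type) (x : dual A) := (dpart1 x, dpart2 x).
Definition dual_of_pair (A : Type) (x : A * A) := Dual x.1 x.2.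
Lemma pair_of_dualK (A : Type) : cancel (@pair_of_dual A) (@dual_of_pair A).
Proof. by case. Qed.

HB.instance Definition _ (A : choiceType) :=
  Choice.copy (dual A) (can_type (@pair_of_dualK A)).
HB.instance Definition _ (A : topologicalType) :=
  Topological.copy (dual A) (initial_topology (@pair_of_dual A)).

Section DualZmodule.
Context (A : zmodType).
Implicit Types x y : dual A.

Definition dual_add x y := Dual (dpart1 x + dpart1 y) (dpart2 x + dpart2 y).
Definition dual_opp x := Dual (- dpart1 x) (- dpart2 x).

Let daddA : associative dual_add.
Proof. by move=> x y z; congr Dual; exact: addrA. Qed.
Let daddC : commutative dual_add.
Proof. by move=> x y; congr Dual; exact: addrC. Qed.
Let dadd0x : left_id (Dual 0 0) dual_add.
Proof. by case=> a b; congr Dual; exact: add0r. Qed.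
Let daddNx : left_inverse (Dual 0 0) dual_opp dual_add.
Proof. by move=> x; congr Dual; exact: addNr. Qed.

HB.instance Definition _ :=
  GRing.isZmodule.Build (dual A) daddA daddC dadd0x daddNx.

End DualZmodule.

Section DualLmodule.
Context (R : pzRingType) (A : lmodType R).
Implicit Types x y : dual A.

Definition dual_scale (k : R) x := Dual (k *: dpart1 x) (k *: dpart2 x).

Let dscaleA a b x : dual_scale a (dual_scale b x) = dual_scale (a * b) x.
Proof. by congr Dual; exact: scalerA. Qed.
Let dscale1x : left_id 1 dual_scale.
Proof. by case=> a b; congr Dual; exact: scale1r. Qed.
Let dscaleDr : right_distributive dual_scale +%R.
Proof. by move=> k x y; congr Dual; exact: scalerDr. Qed.
Let dscaleDl x : {morph dual_scale^~ x : a b / a + b}.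
Proof. by move=> a b; congr Dual; exact: scalerDl. Qed.

HB.instance Definition _ := GRing.Zmodule_isLmodule.Build R (dual A)
  dscaleA dscale1x dscaleDr dscaleDl.

End DualLmodule.

Section DualRing.
Context (A : nzRingType).
Implicit Types x y : dual A.

Definition dual_mul x y :=
  Dual (dpart1 x * dpart1 y) (dpart1 x * dpart2 y + dpart2 x * dpart1 y).

Let dmulA : associative dual_mul.
Proof.
by move=> x y z; congr Dual; rewrite /= ?mulrDr ?mulrDl !mulrA ?addrA.
Qed.
Let dmul1x : left_id (Dual 1 0) dual_mul.
Proof. by case=> a b; congr Dual; rewrite /= !(mul1r, mul0r, addr0). Qed.
Let dmulx1 : right_id (Dual 1 0) dual_mul.
Proof. by case=> a b; congr Dual; rewrite /= !(mulr1, mulr0, add0r). Qed.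
Let dmulDl : left_distributive dual_mul +%R.
Proof. by move=> x y z; congr Dual; rewrite /= !mulrDl // addrACA. Qed.
Let dmulDr : right_distributive dual_mul +%R.
Proof. by move=> x y z; congr Dual; rewrite /= !mulrDr // addrACA. Qed.
Let dual1_neq0 : Dual 1 0 != 0 :> dual A.
Proof. by apply/eqP => -[/eqP]; rewrite oner_eq0. Qed.

HB.instance Definition _ := GRing.Zmodule_isNzRing.Build (dual A)
  dmulA dmul1x dmulx1 dmulDl dmulDr dual1_neq0.

End DualRing.

Fact dual_mulC (A : comNzRingType) (x y : dual A) : x * y = y * x.
Proof. by congr Dual; rewrite /= mulrC // addrC (mulrC (dpart1 y)). Qed.

HB.instance Definition _ (A : comNzRingType) :=
  GRing.PzRing_hasCommutativeMul.Build (dual A) (@dual_mulC A).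

Fact dual_scalerAl (R : nzRingType) (A : lalgType R) (k : R) (x y : dual A) :
  k *: (x * y) = k *: x * y.
Proof. by congr Dual; rewrite /= ?scalerDr !scalerAl. Qed.

HB.instance Definition _ (R : nzRingType) (A : lalgType R) :=
  GRing.Lmodule_isLalgebra.Build R (dual A) (@dual_scalerAl R A).

Fact dual_scalerAr (R : nzRingType) (A : algType R) (k : R) (x y : dual A) :
  k *: (x * y) = x * (k *: y).
Proof. by congr Dual; rewrite /= ?scalerDr !scalerAr. Qed.

HB.instance Definition _ (R : nzRingType) (A : algType R) :=
  GRing.Lalgebra_isAlgebra.Build R (dual A) (@dual_scalerAr R A).

HB.instance Definition _ (R : nzRingType) (A : comAlgType R) :=
  GRing.Algebra.on (dual A).

Definition dconj (A : Type) (c : A -> A) (x : dual A) :=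
  Dual (c (dpart1 x)) (c (dpart2 x)).

Lemma dconj_star (R : nzRingType) (A : algType R) (c : A -> A) :
  star_involution c -> star_involution (dconj c).
Proof.
move=> [clin cK cM].
have cD u v : c (u + v) = c u + c v by have := clin 1 u v; rewrite !scale1r.
split=> [k x y|[a b]|x y].
- by congr Dual; exact: clin.
- by rewrite /dconj /= !cK.
- by congr Dual; rewrite /= ?cD !cM // addrC.
Qed.

(* [Cplx a b] is a + e1 b, with e1 central of square -1 *)
Record cplx (A : Type) := Cplx { cpart1 : A; cpart2 : A }.

Definition pair_of_cplx (A : Type) (x : cplx A) := (cpart1 x, cpart2 x).
Definition cplx_of_pair (A : Type) (x : A * A) := Cplx x.1 x.2.
Lemma pair_of_cplxK (A : Type) : cancel (@pair_of_cplx A) (@cplx_of_pair A).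
Proof. by case. Qed.

HB.instance Definition _ (A : choiceType) :=
  Choice.copy (cplx A) (can_type (@pair_of_cplxK A)).
HB.instance Definition _ (A : topologicalType) :=
  Topological.copy (cplx A) (initial_topology (@pair_of_cplx A)).

Section CplxRing.
Context (A : comNzRingType).
Implicit Types x y : cplx A.

Definition cplx_add x y := Cplx (cpart1 x + cpart1 y) (cpart2 x + cpart2 y).
Definition cplx_opp x := Cplx (- cpart1 x) (- cpart2 x).
Definition cplx_mul x y :=
  Cplx (cpart1 x * cpart1 y - cpart2 x * cpart2 y)
       (cpart1 x * cpart2 y + cpart2 x * cpart1 y).
Definition cconj x := Cplx (cpart1 x) (- cpart2 x).

Let caddA : associative cplx_add.
Proof. by move=> x y z; congr Cplx; exact: addrA. Qed.
Let caddC : commutative cplx_add.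
Proof. by move=> x y; congr Cplx; exact: addrC. Qed.
Let cadd0x : left_id (Cplx 0 0) cplx_add.
Proof. by case=> a b; congr Cplx; exact: add0r. Qed.
Let caddNx : left_inverse (Cplx 0 0) cplx_opp cplx_add.
Proof. by move=> x; congr Cplx; exact: addNr. Qed.

HB.instance Definition _ :=
  GRing.isZmodule.Build (cplx A) caddA caddC cadd0x caddNx.

Let cmulA : associative cplx_mul.
Proof. by move=> x y z; congr Cplx; rewrite /=; ring. Qed.
Let cmulC : commutative cplx_mul.
Proof. by move=> x y; congr Cplx; ring. Qed.
Let cmul1x : left_id (Cplx 1 0) cplx_mul.
Proof. by case=> a b; congr Cplx; rewrite /=; ring. Qed.
Let cmulDl : left_distributive cplx_mul +%R.
Proof. by move=> x y z; congr Cplx; rewrite /=; ring. Qed.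
Let cplx1_neq0 : Cplx 1 0 != 0 :> cplx A.
Proof. by apply/eqP => -[/eqP]; rewrite oner_eq0. Qed.

HB.instance Definition _ := GRing.Zmodule_isComNzRing.Build (cplx A)
  cmulA cmulC cmul1x cmulDl cplx1_neq0.

End CplxRing.

Section CplxAlgebra.
Context (R : nzRingType) (A : comAlgType R).
Implicit Types x y : cplx A.

Definition cplx_scale (k : R) x := Cplx (k *: cpart1 x) (k *: cpart2 x).

Let cscaleA a b x : cplx_scale a (cplx_scale b x) = cplx_scale (a * b) x.
Proof. by congr Cplx; exact: scalerA. Qed.
Let cscale1x : left_id 1 cplx_scale.
Proof. by case=> a b; congr Cplx; exact: scale1r. Qed.
Let cscaleDr : right_distributive cplx_scale +%R.
Proof. by move=> k x y; congr Cplx; exact: scalerDr. Qed.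
Let cscaleDl x : {morph cplx_scale^~ x : a b / a + b}.
Proof. by move=> a b; congr Cplx; exact: scalerDl. Qed.

HB.instance Definition _ := GRing.Zmodule_isLmodule.Build R (cplx A)
  cscaleA cscale1x cscaleDr cscaleDl.

Let cplx_scalerAl (k : R) x y : k *: (x * y) = k *: x * y.
Proof. by congr Cplx; rewrite /= scalerDr ?scalerN !scalerAl. Qed.

HB.instance Definition _ :=
  GRing.Lmodule_isLalgebra.Build R (cplx A) cplx_scalerAl.
HB.instance Definition _ := GRing.Lalgebra_isComAlgebra.Build R (cplx A).

Lemma cconj_star : star_involution (@cconj A).
Proof.
split=> [k x y|[a b]|x y].
- by congr Cplx; rewrite /= opprD scalerN.
- by rewrite /cconj /= opprK.
- by congr Cplx; rewrite /=; ring.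
Qed.

End CplxAlgebra.

Section DualQuaternions.
Context (R : realType).

(* R^o is R as an algebra over itself *)
Definition DR := dual R^o.
Definition DRC := cplx (dual R^o).
Definition DH := dual (quat R).

Definition dhconj : DH -> DH := dconj (@qconj R).
Definition drcconj : DRC -> DRC := @cconj (dual R^o).

Lemma dhconj_star : @star_involution R DH dhconj.
Proof. exact/dconj_star/qconj_star. Qed.

Lemma drcconj_star : @star_involution R DRC drcconj.
Proof. exact: cconj_star. Qed.

Definition dheps : DH := Dual 0 1.
Definition dhi : DH := Dual (qi R) 0.

Definition DH_of_DR (a : DR) : DH := Dual (dpart1 a)%:A (dpart2 a)%:A.
Definition DR_in_DH : set DH := range DH_of_DR.
Definition R_in_DH : set DH := range (fun r : R => r%:A : DH).
Definition R_epsH : set DH := [set Dual r%:A h | r in [set: R] & h in setT].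

Definition SDH : set DH := [set J | J + dhconj J = 0 /\ J * dhconj J = 1].

Definition CJ (J : DH) : set DH := rspan [:: 1; J].
Definition QDH : set DH := \bigcup_(J in SDH) CJ J.

Definition TJ (J1 : quat R) : set DH :=
  [set Dual J1 x2 | x2 in [set x2 | ImH x2 /\ qdot x2 J1 = 0]].

Definition RC : set DRC :=
  [set Cplx (Dual a1 0) (Dual b1 0) | a1 in [set: R] & b1 in [set: R]].
Definition RCplus : set DRC :=
  [set Cplx (Dual a1 0) (Dual b1 0) | a1 in [set: R] & b1 in [set b | 0 < b]].
Definition DRCplus : set DRC :=
  [set z + Cplx (Dual 0 1) 0 * w | z in RCplus & w in RC].

Definition phi (J : DH) (z : DRC) : DH :=
  DH_of_DR (cpart1 z) + J * DH_of_DR (cpart2 z).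
Definition Phi (x : DH * DRC) : DH := phi x.1 x.2.

(* preimage under Phi restricted to its domain SDH x DRC *)
Definition Phi_fiber (x : DH) : set (DH * DRC) :=
  (SDH `*` setT) `&` Phi @^-1` [set x].

Definition DC (J : DH) : set DH := range (phi J).
Definition DCplus (J : DH) : set DH := phi J @` DRCplus.
Definition CJplus (J : DH) : set DH := phi J @` RCplus.

(* the dual complex numbers C + epsilon C, with C = span(1, i) in H *)
Definition Ci : set (quat R) := rspan [:: 1; qi R].
Definition dual_complex : set DH := [set Dual z w | z in Ci & w in Ci].

End DualQuaternions.

Arguments SDH : clear implicits.
Arguments DR_in_DH : clear implicits.
Arguments R_in_DH : clear implicits.
Arguments R_epsH : clear implicits.
Arguments QDH : clear implicits.
Arguments RC : clear implicits.
Arguments RCplus : clear implicits.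
Arguments DRCplus : clear implicits.
Arguments dual_complex : clear implicits.
Arguments Phi : clear implicits.
Arguments dhconj : clear implicits.
Arguments drcconj : clear implicits.

(* Main.v *)
From HB Require Import structures.
Require Import Defs.
From mathcomp Require Import all_boot all_order all_algebra.
From mathcomp Require Import all_classical all_reals all_analysis.
From mathcomp Require Import ring.
Set Implicit Arguments.
Unset Strict Implicit.
Unset Printing Implicit Defensive.
Import Order.TTheory GRing.Theory Num.Theory.
Import numFieldNormedType.Exports.
Local Open Scope classical_set_scope.
Local Open Scope ring_scope.

(** Write J = J1 + eps J2 with J1 a unit imaginary quaternion and J2 imaginary
    and orthogonal to J1.  For z = a + e1 b with a = a1 + eps a2 and
    b = b1 + eps b2, [phiE] gives
      phi J z = (a1 + b1 J1) + eps (a2 + (b2 J1 + b1 J2)),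
    so everything is decided by the real parts a1, a2 and by the imaginary
    vectors b1 J1 and b2 J1 + b1 J2.

    The first vector determines b1 up to sign, as its norm is |b1|.  If b1 <> 0,
    the choice of sign determines J1, then b2 = (b2 J1 + b1 J2) . J1 because J1
    and J2 are orthogonal, and finally J2: the only freedom is
    (J, z) -> (-J, conj z) ([phi_eq_nonreal]).  If b1 = 0 <> b2, only b2 J1
    survives, which determines (J1, b2) up to a common sign and leaves J2 free
    ([phi_eq_infinitesimal]).  If b = 0 then J is entirely free.  These three
    cases give the intersections of the slices DC_J and the fibres of Phi.

    Since the real dual numbers are central in DH and J^2 = -1, phi J is a
    morphism of algebras; it turns conjugation of e1 into that of DH because
    J^c = -J, and it is injective by the previous discussion.  Hence the
    star-algebra isomorphism with DC_J.

    When the primal part of x is not real, the recipe above is an explicit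
    formula, [polar], for the unique pair (J, z) with b1 > 0 and phi J z = x.
    It involves only polynomials, a square root and division by the nonzero
    number b1, so it is continuous off R + eps H, and it inverts Phi there:
    this yields both homeomorphisms, and the surjectivity statements off
    R + eps H. *)

(** * Real and imaginary parts of quaternions *)

Lemma quatP (R : Type) (x y : quat R) :
  q0 x = q0 y -> q1 x = q1 y -> q2 x = q2 y -> q3 x = q3 y -> x = y.
Proof. by case: x => ? ? ? ?; case: y => ? ? ? ? /= -> -> -> ->. Qed.

Lemma dualP (A : Type) (x y : dual A) :
  dpart1 x = dpart1 y -> dpart2 x = dpart2 y -> x = y.
Proof. by case: x => ? ?; case: y => ? ? /= -> ->. Qed.

Lemma cplxP (A : Type) (x y : cplx A) :
  cpart1 x = cpart1 y -> cpart2 x = cpart2 y -> x = y.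
Proof. by case: x => ? ?; case: y => ? ? /= -> ->. Qed.

Definition qvec (R : comNzRingType) (x : quat R) : quat R :=
  Quat 0 (q1 x) (q2 x) (q3 x).

Lemma qE (R : comNzRingType) (x : quat R) : x = (q0 x)%:A + qvec x.
Proof. by apply: quatP => /=; ring. Qed.

Lemma q0_realD (R : comNzRingType) (a : R) (v : quat R) :
  ImH v -> q0 (a%:A + v) = a.
Proof. by rewrite /ImH /= => ->; ring. Qed.

Lemma qvec_realD (R : comNzRingType) (a : R) (v : quat R) :
  ImH v -> qvec (a%:A + v) = v.
Proof. by rewrite /ImH /= => v0; apply: quatP; rewrite /= ?v0 //; ring. Qed.

Lemma ImH_qvec (R : comNzRingType) (v : quat R) : ImH (qvec v).
Proof. by []. Qed.

Lemma ImHD (R : comNzRingType) (u v : quat R) : ImH u -> ImH v -> ImH (u + v).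
Proof. by rewrite /ImH /= => -> ->; rewrite addr0. Qed.

Lemma ImHZ (R : comNzRingType) k (v : quat R) : ImH v -> ImH (k *: v).
Proof. by rewrite /ImH /= => ->; rewrite mulr0. Qed.

Lemma qdotDl (R : comNzRingType) (x y z : quat R) :
  qdot (x + y) z = qdot x z + qdot y z.
Proof. by rewrite /qdot /=; ring. Qed.

Lemma qdotZl (R : comNzRingType) k (x y : quat R) :
  qdot (k *: x) y = k * qdot x y.
Proof. by rewrite /qdot /=; ring. Qed.

Lemma qdotZr (R : comNzRingType) k (x y : quat R) :
  qdot x (k *: y) = k * qdot x y.
Proof. by rewrite /qdot /=; ring. Qed.

Lemma qdotNl (R : comNzRingType) (x y : quat R) : qdot (- x) y = - qdot x y.
Proof. by rewrite /qdot /=; ring. Qed.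

Lemma qdotNr (R : comNzRingType) (x y : quat R) : qdot x (- y) = - qdot x y.
Proof. by rewrite /qdot /=; ring. Qed.

Lemma qdot_ge0 (R : realDomainType) (v : quat R) : 0 <= qdot v v.
Proof. by rewrite /qdot !addr_ge0 // -expr2 sqr_ge0. Qed.

Lemma qdot_eq0 (R : realDomainType) (v : quat R) : qdot v v = 0 -> v = 0.
Proof.
rewrite /qdot -!expr2 => /eqP.
rewrite !paddr_eq0 ?addr_ge0 ?sqr_ge0 // !expf_eq0 /= => /andP[/andP[/andP[]]].
by move=> /eqP ? /eqP ? /eqP ? /eqP ?; apply: quatP.
Qed.

(** * Dual imaginary units and the map phi *)

(** The primal and dual components of J J^c are x x^c and x y^c + y x^c for
    J = x + eps y: they are real, and measure the norm of x and the angle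
    between x and y. *)
Lemma qmul_conjD (R : comNzRingType) (x y : quat R) :
  x * qconj y + y * qconj x = (qdot x y *+ 2)%:A.
Proof. by apply: quatP; rewrite /qdot /=; ring. Qed.

Lemma qmul_conj (R : comNzRingType) (x : quat R) :
  x * qconj x = (qdot x x)%:A.
Proof. by apply: quatP; rewrite /qdot /=; ring. Qed.

Lemma qaddconj (R : comNzRingType) (x : quat R) :
  x + qconj x = (q0 x *+ 2)%:A.
Proof. by apply: quatP; rewrite /=; ring. Qed.

Lemma qreal_inj (R : comNzRingType) (a b : R) :
  a%:A = b%:A :> quat R -> a = b.
Proof. by case; rewrite !mulr1. Qed.

(** The description of the dual sphere as the tangent bundle of the sphere of
    imaginary units, which turns the algebraic conditions defining it into
    Euclidean ones. *)
Lemma SDHP (R : realType) (J : DH R) :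
  SDH R J <-> [/\ ImH (dpart1 J), ImH (dpart2 J),
                 qdot (dpart1 J) (dpart1 J) = 1 &
                 qdot (dpart2 J) (dpart1 J) = 0].
Proof.
have mul20 (r : R) : ((r *+ 2)%:A = 0 :> quat R) = (r = 0).
  apply/propext; split=> [|->]; last by rewrite mul0rn scale0r.
  by rewrite -(scale0r 1) => /qreal_inj/eqP; rewrite mulrn_eq0 => /eqP.
case: J => x y; rewrite /ImH /= -!mul20 -!qaddconj -qmul_conjD (addrC (y * _)).
split=> [[/[dup] /(congr1 (@dpart1 _)) ? /(congr1 (@dpart2 _)) ?] /[dup]|].
  move=> /(congr1 (@dpart1 _)) e1 /(congr1 (@dpart2 _)) ?; split=> //.
  by apply: qreal_inj; rewrite -qmul_conj scale1r.
case=> ? ? e3 ?; split; apply: dualP => //=.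
by rewrite qmul_conj e3 scale1r.
Qed.

Lemma SDHN (R : realType) (J : DH R) : SDH R J -> SDH R (- J).
Proof.
move=> /SDHP[J1 J2 n o]; apply/SDHP.
by split; rewrite /ImH /= ?J1 ?J2 ?oppr0 // qdotNl qdotNr opprK.
Qed.

Lemma TJP (R : realType) (K L : DH R) : SDH R K ->
  TJ (dpart1 K) L <-> SDH R L /\ dpart1 L = dpart1 K.
Proof.
move=> /SDHP[K1 K2 n o]; split.
  by case=> v [v0 vK] <-; split=> //; apply/SDHP.
case: L => L1 L2 /= [/SDHP[/= a b c d] e]; subst L1.
by exists L2.
Qed.

Lemma phiE (R : realType) (J : DH R) (z : DRC R) :
  phi J z =
  Dual ((dpart1 (cpart1 z) : R)%:A + (dpart1 (cpart2 z) : R) *: dpart1 J)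
       ((dpart2 (cpart1 z) : R)%:A +
        ((dpart2 (cpart2 z) : R) *: dpart1 J +
         (dpart1 (cpart2 z) : R) *: dpart2 J)).
Proof.
rewrite /phi /DH_of_DR; apply: dualP => /=.
  by rewrite -scalerAr mulr1.
by rewrite -!scalerAr !mulr1.
Qed.

Lemma ImH_phi (R : realType) (J : DH R) (b1 b2 : R) : SDH R J ->
  ImH (b1 *: dpart1 J) /\ ImH (b2 *: dpart1 J + b1 *: dpart2 J).
Proof.
by move=> /SDHP[J1 J2 _ _]; split; [|apply: ImHD]; exact: ImHZ.
Qed.

Lemma phi_eqP (R : realType) (J K : DH R) (z w : DRC R) :
  SDH R J -> SDH R K ->
  phi J z = phi K w <->
  [/\ cpart1 z = cpart1 w,
      dpart1 (cpart2 z) *: dpart1 J = dpart1 (cpart2 w) *: dpart1 K :> quat R &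
      dpart2 (cpart2 z) *: dpart1 J + dpart1 (cpart2 z) *: dpart2 J =
      dpart2 (cpart2 w) *: dpart1 K + dpart1 (cpart2 w) *: dpart2 K :> quat R].
Proof.
move=> hJ hK; rewrite !phiE.
have [vJ1 vJ2] := ImH_phi (dpart1 (cpart2 z)) (dpart2 (cpart2 z)) hJ.
have [vK1 vK2] := ImH_phi (dpart1 (cpart2 w)) (dpart2 (cpart2 w)) hK.
split=> [e|[-> -> ->] //].
have e1 := congr1 (@dpart1 _) e; have e2 := congr1 (@dpart2 _) e.
rewrite /= in e1 e2; split.
- apply: dualP.
    by move/(congr1 (@q0 _)): e1; rewrite !q0_realD.
  by move/(congr1 (@q0 _)): e2; rewrite !q0_realD.
- by move/(congr1 (@qvec _)): e1; rewrite !qvec_realD.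
- by move/(congr1 (@qvec _)): e2; rewrite !qvec_realD.
Qed.

Lemma phiN (R : realType) (J : DH R) (z : DRC R) :
  phi (- J) (cconj z) = phi J z.
Proof.
by rewrite !phiE; apply: dualP; rewrite /= !(scalerN, scaleNr) !opprK.
Qed.

Lemma cconj_involutive (A : comNzRingType) : involutive (@cconj A).
Proof. by case=> a b; rewrite /cconj /= opprK. Qed.

Lemma DCN (R : realType) (J : DH R) : DC (- J) = DC J.
Proof.
rewrite eqEsubset; split=> _ [z _ <-].
  by exists (cconj z) => //; rewrite -phiN cconj_involutive.
by exists (cconj z); rewrite // phiN.
Qed.

Lemma phi_injr (R : realType) (J : DH R) (z w : DRC R) :
  SDH R J -> phi J z = phi J w -> z = w.
Proof.
move=> hJ /phi_eqP[]// ea e1 e2; have /SDHP[_ _ n o] := hJ.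
apply: cplxP => //; apply: dualP.
  by move/(congr1 (fun v => qdot v (dpart1 J))): e1; rewrite !qdotZl n !mulr1.
move/(congr1 (fun v => qdot v (dpart1 J))): e2.
by rewrite !qdotDl !qdotZl n o !(mulr1, mulr0, addr0).
Qed.

Lemma scaler_unit_sign (R : realType) (u v : quat R) (r s : R) :
  qdot u u = 1 -> qdot v v = 1 -> r *: u = s *: v -> r = s \/ r = - s.
Proof.
move=> nu nv /(congr1 (fun x => qdot x x)).
rewrite !qdotZl !qdotZr nu nv !mulr1 -!expr2 => /eqP.
by rewrite eqf_sqr => /orP[]/eqP; [left|right].
Qed.

(** * Uniqueness of the representation *)

(** Equality of the primal vectors gives J1 = K1.  Projecting the dual vectors
    b2 J1 + b1 J2 on J1 kills the terms in J2 and K2, so the b2 agree, and what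
    remains is b1 J2 = b1 K2 with b1 invertible. *)
Lemma phi_eq_same_sign (R : realType) (J K : DH R) (z w : DRC R) :
  SDH R J -> SDH R K -> dpart1 (cpart2 z) != 0 ->
  dpart1 (cpart2 z) = dpart1 (cpart2 w) -> phi J z = phi K w -> K = J /\ w = z.
Proof.
move=> hJ hK b0 eb e; suff KJ : K = J.
  by split=> //; subst K; exact: (phi_injr hJ).
have [_ e1 e2] := (phi_eqP _ _ hJ hK).1 e.
have /SDHP[_ _ nJ oJ] := hJ; have /SDHP[_ _ nK oK] := hK.
rewrite -eb in e1 e2; have J1 := scalerI b0 e1.
apply: dualP => //.
have J2: dpart2 (cpart2 z) = dpart2 (cpart2 w).
  move/(congr1 (fun v => qdot v (dpart1 J))): e2.
  by rewrite [in RHS]J1 !qdotDl !qdotZl nJ nK oJ oK !(mulr1, mulr0, addr0).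
by apply: (scalerI b0); move: e2; rewrite J1 J2 => /addrI ->.
Qed.

(** Comparing the norms of the primal vectors leaves a sign; the negative one
    is reduced to the positive one by replacing (K, w) with (-K, conj w), which
    has the same image. *)
Lemma phi_eq_nonreal (R : realType) (J K : DH R) (z w : DRC R) :
  SDH R J -> SDH R K -> dpart1 (cpart2 z) != 0 -> phi J z = phi K w ->
  (K = J /\ w = z) \/ (K = - J /\ w = cconj z).
Proof.
move=> hJ hK b0 e; have [_ e1 _] := (phi_eqP _ _ hJ hK).1 e.
have /SDHP[_ _ nJ _] := hJ; have /SDHP[_ _ nK _] := hK.
have [eb|eb] := scaler_unit_sign nJ nK e1.
  by left; exact: (phi_eq_same_sign hJ hK).
right; rewrite -(phiN K) in e.
have [<- <-] := phi_eq_same_sign (w := cconj w) hJ (SDHN hK) b0 eb e.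
by rewrite opprK cconj_involutive.
Qed.

Lemma phi_eq_real (R : realType) (J K : DH R) (z w : DRC R) :
  SDH R J -> SDH R K -> dpart1 (cpart2 z) = 0 -> phi J z = phi K w ->
  [/\ cpart1 w = cpart1 z, dpart1 (cpart2 w) = 0 &
   (dpart2 (cpart2 z) *: dpart1 J = dpart2 (cpart2 w) *: dpart1 K :> quat R)].
Proof.
move=> hJ hK b0 /phi_eqP[]// ea; rewrite b0 scale0r => e1.
have /SDHP[_ _ nK _] := hK.
have c0 : dpart1 (cpart2 w) = 0.
  move/(congr1 (fun v => qdot v (dpart1 K))): e1.
  by rewrite qdotZl nK mulr1 /qdot /= !mul0r !addr0.
by rewrite c0 !scale0r !addr0.
Qed.

(** The components J2 and K2 enter phi only multiplied by b1 = 0, hence only the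
    primal parts of the units can be compared. *)
Lemma phi_eq_infinitesimal (R : realType) (J K : DH R) (z w : DRC R) :
  SDH R J -> SDH R K -> dpart1 (cpart2 z) = 0 -> dpart2 (cpart2 z) != 0 ->
  phi J z = phi K w ->
  (dpart1 K = dpart1 J /\ w = z) \/ (dpart1 K = - dpart1 J /\ w = cconj z).
Proof.
move=> hJ hK b0 b20 /(phi_eq_real hJ hK b0)[ea c0 e].
have /SDHP[_ _ nJ _] := hJ; have /SDHP[_ _ nK _] := hK.
have [eb|eb] := scaler_unit_sign nJ nK e.
  left; split; first by move: e; rewrite -eb => /(scalerI b20) ->.
  by apply: cplxP => //; apply: dualP => //; rewrite b0 c0.
right; split.
  by apply: (scalerI b20); rewrite scalerN e eb scaleNr.
apply: cplxP => //; apply: dualP => /=; first by rewrite b0 c0 oppr0.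
by rewrite eb opprK.
Qed.

(** * The slices DC_J as star-algebras *)

Lemma phi_linear (R : realType) (J : DH R) : linear (phi J).
Proof.
move=> c z w; rewrite !phiE; apply: dualP => /=.
  by rewrite !(scalerDl, scalerDr, scalerA) addrACA.
rewrite !(scalerDl, scalerDr, scalerA) [RHS]addrACA; congr (_ + _).
exact: addrACA.
Qed.

Lemma DH_of_DRM (R : realType) (a b : DR R) :
  DH_of_DR (a * b) = DH_of_DR a * DH_of_DR b.
Proof.
apply: dualP => /=; rewrite !mulr_algl !scalerA //.
by rewrite scalerDl.
Qed.

Lemma DH_of_DRB (R : realType) (a b : DR R) :
  DH_of_DR (a - b) = DH_of_DR a - DH_of_DR b.
Proof. by apply: dualP; rewrite /= scalerBl. Qed.

Lemma DH_of_DRD (R : realType) (a b : DR R) :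
  DH_of_DR (a + b) = DH_of_DR a + DH_of_DR b.
Proof. by apply: dualP; rewrite /= scalerDl. Qed.

Lemma DH_of_DR_central (R : realType) (a : DR R) (x : DH R) :
  DH_of_DR a * x = x * DH_of_DR a.
Proof. by apply: dualP; rewrite /= !mulr_algl !mulr_algr // addrC. Qed.

Lemma SDH_sqr (R : realType) (J : DH R) : SDH R J -> J * J = -1.
Proof.
by case=> /eqP; rewrite addr_eq0 => /eqP e n; rewrite {2}e mulrN n.
Qed.

(** In (a + J b) (c + J d) the central factor b moves across J, and J^2 = -1
    yields the multiplication of DRC. *)
Lemma phi_monoid_morphism (R : realType) (J : DH R) : SDH R J ->
  monoid_morphism (phi J).
Proof.
move=> hJ; split=> [|[a b] [c d]]; rewrite /phi /=.
  by apply: dualP; rewrite /= ?scale1r ?scale0r ?mulr0 !addr0.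
rewrite DH_of_DRB DH_of_DRD !DH_of_DRM !(mulrDl, mulrDr).
have -> : J * DH_of_DR b * (J * DH_of_DR d) = - (DH_of_DR b * DH_of_DR d).
  rewrite -mulrA (mulrA (DH_of_DR b)) DH_of_DR_central -mulrA mulrA.
  by rewrite SDH_sqr // mulN1r.
rewrite (mulrA _ J) (DH_of_DR_central a J) !mulrA -!addrA; congr (_ + _).
by rewrite addrC addrA.
Qed.

Lemma phi_star (R : realType) (J : DH R) (z : DRC R) : SDH R J ->
  phi J (drcconj R z) = dhconj R (phi J z).
Proof.
move=> /SDHP[J1 J2 _ _]; rewrite !phiE /dhconj /dconj /=.
have conjE (r : R) (v : quat R) : ImH v -> qconj (r%:A + v) = r%:A - v.
  by move=> v0; apply: quatP; rewrite /= ?v0 ?mulr0 ?add0r ?oppr0.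
by apply: dualP; rewrite /= conjE ?scaleNr ?opprD //;
   do ?apply: ImHD; exact: ImHZ.
Qed.

Lemma DC_star_isomorphic (R : realType) (J : DH R) : SDH R J ->
  @star_isomorphic_to_sub R (DRC R) (DH R) (drcconj R) (dhconj R) (DC J).
Proof.
move=> hJ.
exists (HB.pack_for {lrmorphism DRC R -> DH R} (phi J)
  (GRing.isLinear.Build _ _ _ _ _ (phi_linear J))
  (GRing.isMonoidMorphism.Build _ _ _ (phi_monoid_morphism hJ))).
split=> [z w||z] //=; first exact: phi_injr hJ.
exact: phi_star.
Qed.

Lemma DC_star_subalgebra (R : realType) (J : DH R) : SDH R J ->
  @star_subalgebra R (DH R) (dhconj R) (DC J).
Proof.
move=> /DC_star_isomorphic[f [_ <- fstar]]; split.
  split=> [|k _ _ /set_mem[z _ <-] /set_mem[w _ <-]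
           |_ _ /set_mem[z _ <-] /set_mem[w _ <-]]; apply: mem_set.
  - by exists 1; rewrite // rmorph1.
  - by exists (k *: z + w); rewrite // linearP.
  - by exists (z * w); rewrite // rmorphM.
by move=> _ [z _ <-]; exists (drcconj R z).
Qed.

Lemma SDH_i (R : realType) : SDH R (dhi R).
Proof.
apply/SDHP; rewrite /dhi /qi /ImH /qdot /=.
by rewrite !(mulr0, mul0r, mulr1, add0r, addr0).
Qed.

Lemma rspan2 (R : pzRingType) (V : lmodType R) (u v : V) :
  rspan [:: u; v] = [set x | exists a b : R, x = a *: u + b *: v].
Proof.
rewrite eqEsubset; split=> x /=.
  case=> k ->; rewrite !big_ord_recl big_ord0 addr0 /=.
  by do 2 eexists.
case=> a [b ->]; exists (tnth [tuple a; b]).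
by rewrite !big_ord_recl big_ord0 addr0.
Qed.

Lemma rspan3 (R : pzRingType) (V : lmodType R) (u v w : V) :
  rspan [:: u; v; w] =
  [set x | exists a b c : R, x = a *: u + b *: v + c *: w].
Proof.
rewrite eqEsubset; split=> x /=.
  case=> k ->; rewrite !big_ord_recl big_ord0 addr0 addrA /=.
  by do 3 eexists.
case=> a [b [c ->]]; exists (tnth [tuple a; b; c]).
by rewrite !big_ord_recl big_ord0 addr0 addrA.
Qed.

Lemma DC_i (R : realType) : DC (dhi R) = dual_complex R.
Proof.
rewrite /dual_complex /Ci rspan2 eqEsubset; split=> x.
  case=> z _ <-; rewrite phiE /=.
  exists ((dpart1 (cpart1 z) : R)%:A + (dpart1 (cpart2 z) : R) *: qi R).
    by do 2 eexists.
  exists ((dpart2 (cpart1 z) : R)%:A + (dpart2 (cpart2 z) : R) *: qi R).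
    by do 2 eexists.
  by rewrite scaler0 addr0.
case=> _ [a [b ->]] [_ [c [d ->]] <-].
exists (Cplx (Dual (a : R^o) (c : R^o)) (Dual (b : R^o) (d : R^o))) => //.
by rewrite phiE /= scaler0 addr0.
Qed.

(** * Intersections of slices *)

Lemma R_epsHP (R : realType) (x : DH R) :
  R_epsH R x <-> qvec (dpart1 x) = 0.
Proof.
split=> [[r _ [h _ <-]] /=|x0]; first by apply: quatP; rewrite /= ?mulr0.
exists (q0 (dpart1 x)) => //; exists (dpart2 x) => //.
by apply: dualP; rewrite //= [RHS]qE x0 addr0.
Qed.

Lemma DR_sub_DC (R : realType) (J : DH R) : DR_in_DH R `<=` DC J.
Proof.
move=> _ [a _ <-]; exists (Cplx a 0) => //.
by rewrite phiE; apply: dualP; rewrite /= !scale0r ?addr0.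
Qed.

(** These are the elements a1 + eps (a2 + b2 J1), the values of phi J at the
    points with b1 = 0; they depend on J1 only. *)
Lemma rspan_1_eps_epsJ (R : realType) (J1 : quat R) :
  rspan [:: 1; dheps R; dheps R * Dual J1 0] =
  [set x | exists a1 a2 b2 : R, x = Dual a1%:A (a2%:A + b2 *: J1)].
Proof.
rewrite rspan3; congr mkset; apply/funext => x.
apply/propext; split=> -[a1 [a2 [b2 ->]]]; exists a1, a2, b2;
  by apply: dualP; rewrite /= ?mul0r ?mul1r ?mulr0 ?scaler0 ?addr0 ?add0r.
Qed.

Lemma DC_infinitesimal (R : realType) (J : DH R) (a1 a2 b2 : R) :
  DC J (Dual a1%:A (a2%:A + b2 *: dpart1 J)).
Proof.
exists (Cplx (Dual (a1 : R^o) (a2 : R^o)) (Dual (0 : R^o) (b2 : R^o))) => //.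
by rewrite phiE /= !scale0r !addr0.
Qed.

(** A common element with b1 <> 0 would force I = J or I = - J, so only the
    elements with b1 = 0 remain, and their set depends on the line through I1
    only. *)
Lemma DCI_same_tangent (R : realType) (I J : DH R) : SDH R I -> SDH R J ->
  ~ (I = J \/ I = - J) -> dpart1 I = dpart1 J \/ dpart1 I = - dpart1 J ->
  DC I `&` DC J = rspan [:: 1; dheps R; dheps R * Dual (dpart1 I) 0].
Proof.
move=> hI hJ neIJ I1; rewrite rspan_1_eps_epsJ eqEsubset; split=> x.
  case=> -[z _ <-] [w _ /esym e].
  have [b0|b0] := eqVneq (dpart1 (cpart2 z)) 0; last first.
    have [[JI _]|[JI _]] := phi_eq_nonreal hI hJ b0 e; case: neIJ.
      by left.
    by right; rewrite JI opprK.
  exists (dpart1 (cpart1 z)), (dpart2 (cpart1 z)), (dpart2 (cpart2 z)).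
  by rewrite phiE b0 !scale0r !addr0.
case=> a1 [a2 [b2 ->]]; split; first exact: DC_infinitesimal.
case: I1 => ->; first exact: DC_infinitesimal.
by rewrite scalerN -scaleNr; exact: DC_infinitesimal.
Qed.

(** A common element with b1 <> 0 or b2 <> 0 would force I1 and J1 to agree up
    to sign. *)
Lemma DCI_transverse (R : realType) (I J : DH R) : SDH R I -> SDH R J ->
  ~ (dpart1 I = dpart1 J \/ dpart1 I = - dpart1 J) ->
  DC I `&` DC J = DR_in_DH R.
Proof.
move=> hI hJ I1; rewrite eqEsubset; split=> x; last first.
  by move=> Rx; split; exact: DR_sub_DC.
case=> -[z _ <-] [w _ /esym e].
have [b0|b0] := eqVneq (dpart1 (cpart2 z)) 0; last first.
  have [[JI _]|[JI _]] := phi_eq_nonreal hI hJ b0 e; case: I1; rewrite JI.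
    by left.
  by right; rewrite opprK.
have [b20|b20] := eqVneq (dpart2 (cpart2 z)) 0; last first.
  have [[JI _]|[JI _]] := phi_eq_infinitesimal hI hJ b0 b20 e;
    case: I1; rewrite JI.
    by left.
  by right; rewrite opprK.
exists (cpart1 z) => //.
by rewrite phiE b0 b20 !scale0r !addr0.
Qed.

Lemma DR_sub_R_epsH (R : realType) : DR_in_DH R `<=` R_epsH R.
Proof. by move=> _ [a _ <-]; exists (dpart1 a) => //; exists (dpart2 a)%:A. Qed.

Lemma RCplusP (R : realType) (z : DRC R) :
  RCplus R z <-> [/\ 0 < (dpart1 (cpart2 z) : R), dpart2 (cpart1 z) = 0 &
                    dpart2 (cpart2 z) = 0].
Proof.
split=> [[a _ [b b0 <-]] //|].
case: z => [[a1 a2] [b1 b2]] /= [b0 -> ->].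
by exists a1 => //; exists b1.
Qed.

Lemma RCP (R : realType) (z : DRC R) :
  RC R z <-> dpart2 (cpart1 z) = 0 /\ dpart2 (cpart2 z) = 0.
Proof.
split=> [[a _ [b b0 <-]] //|].
case: z => [[a1 a2] [b1 b2]] /= [-> ->].
by exists a1 => //; exists b1.
Qed.

Lemma DRCplusP (R : realType) (z : DRC R) :
  DRCplus R z <-> 0 < (dpart1 (cpart2 z) : R).
Proof.
split=> [[x /RCplusP[x0 _ _] [y _ <-]] /=|].
  by rewrite !mul0r addr0 addr0.
case: z => [[a1 a2] [b1 b2]] /= b0.
exists (Cplx (Dual a1 0) (Dual b1 0)); first exact/RCplusP.
exists (Cplx (Dual a2 0) (Dual b2 0)); first exact/RCP.
by apply: cplxP; apply: dualP => /=; rewrite !(mul0r, mul1r, mulr0);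
  rewrite ?(add0r, addr0, subr0).
Qed.

Lemma sub_RCplus (R : realType) : RCplus R `<=` DRCplus R.
Proof. by move=> z /RCplusP[z0 _ _]; apply/DRCplusP. Qed.

Lemma DCplusI (R : realType) (I J : DH R) : SDH R I -> SDH R J -> I <> J ->
  DCplus I `&` DCplus J = set0.
Proof.
move=> hI hJ IJ; rewrite -subset0 => _ [[z /DRCplusP z0 <-] [w /DRCplusP w0]].
move=> /esym /(phi_eq_nonreal hI hJ (lt0r_neq0 z0))[[JI _]|[_ wz]].
  by apply: IJ.
by move: w0; rewrite wz /= oppr_gt0 => /(lt_trans z0); rewrite ltxx.
Qed.

(** * Polar decomposition and surjectivity *)

(** The candidate for the inverse of Phi: r = b1 is the length of the primal
    vector and u = J1 its direction, s = b2 is the component of the dual vector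
    along u, and its orthogonal remainder is b1 J2. *)
Definition polar (R : realType) (x : DH R) : DH R * DRC R :=
  let v := qvec (dpart1 x) in
  let w := qvec (dpart2 x) in
  let r := Num.sqrt (qdot v v) in
  let u := r^-1 *: v in
  let s := qdot w u in
  (Dual u (r^-1 *: (w - s *: u)),
   Cplx (Dual (q0 (dpart1 x) : R^o) (q0 (dpart2 x) : R^o))
        (Dual (r : R^o) (s : R^o))).

Lemma qnorm_gt0 (R : realType) (v : quat R) : v <> 0 ->
  0 < Num.sqrt (qdot v v).
Proof.
move=> v0; rewrite sqrtr_gt0 lt0r qdot_ge0 andbT.
by apply/eqP => /qdot_eq0.
Qed.

Lemma qnormalized (R : realType) (v : quat R) : v <> 0 ->
  qdot ((Num.sqrt (qdot v v))^-1 *: v) ((Num.sqrt (qdot v v))^-1 *: v) = 1.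
Proof.
move=> v0; have r0 := lt0r_neq0 (qnorm_gt0 v0).
rewrite qdotZl qdotZr -{3}(sqr_sqrtr (qdot_ge0 v)) expr2 mulKf //.
by rewrite mulVf.
Qed.

Lemma polar_SDH (R : realType) (x : DH R) : ~ R_epsH R x -> SDH R (polar x).1.
Proof.
move=> /R_epsHP x0; have n := qnormalized x0; apply/SDHP; split=> //=.
- exact/ImHZ.
- apply/ImHZ/ImHD => //; rewrite -scaleNr; do 2 apply: ImHZ; exact: ImH_qvec.
- by rewrite qdotZl qdotDl qdotNl [X in _ - X]qdotZl n mulr1 subrr mulr0.
Qed.

Lemma polar_DRCplus (R : realType) (x : DH R) :
  ~ R_epsH R x -> DRCplus R (polar x).2.
Proof. by move=> /R_epsHP x0; apply/DRCplusP; exact: qnorm_gt0. Qed.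

Lemma phi_polar (R : realType) (x : DH R) :
  ~ R_epsH R x -> Phi R (polar x) = x.
Proof.
move=> /R_epsHP x0; have r0 := lt0r_neq0 (qnorm_gt0 x0).
rewrite /Phi phiE /polar; apply: dualP; rewrite [RHS]qE /=.
  by rewrite scalerA mulfV // scale1r.
by rewrite [X in _ + (_ + X)]scalerA mulfV // scale1r subrKC.
Qed.

Lemma phi_DRCplus (R : realType) (J : DH R) (z : DRC R) : SDH R J ->
  DRCplus R z -> ~ R_epsH R (phi J z).
Proof.
move=> hJ /DRCplusP b0 /R_epsHP; have /SDHP[J1 _ n _] := hJ.
rewrite phiE /= qvec_realD; last exact: ImHZ.
move/(congr1 (fun v => qdot v (dpart1 J))).
rewrite qdotZl n mulr1 /qdot /= !mul0r !addr0 => b00.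
by move: b0; rewrite b00 ltxx.
Qed.

Lemma phi_inj_DRCplus (R : realType) (J K : DH R) (z w : DRC R) :
  SDH R J -> SDH R K -> DRCplus R z -> DRCplus R w ->
  phi J z = phi K w -> (J, z) = (K, w).
Proof.
move=> hJ hK z0 w0 e; have [JK|/eqP JK] := eqVneq J K.
  by subst K; rewrite (phi_injr hJ e).
suff : (DCplus J `&` DCplus K) (phi J z) by rewrite (DCplusI hJ hK JK).
by split; [exists z | rewrite e; exists w].
Qed.

(** Two-sidedness comes for free: [polar] is a section of Phi with values where
    Phi is injective. *)
Lemma polarK (R : realType) (J : DH R) (z : DRC R) : SDH R J ->
  DRCplus R z -> polar (phi J z) = (J, z).
Proof.
move=> hJ z0; have nx := phi_DRCplus hJ z0.
rewrite [LHS]surjective_pairing; apply: phi_inj_DRCplus => //.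
- exact: polar_SDH.
- exact: polar_DRCplus.
- exact: phi_polar.
Qed.

Lemma bigcup_DCplus (R : realType) :
  \bigcup_(K in SDH R) DCplus K = ~` R_epsH R.
Proof.
rewrite eqEsubset; split=> [_ [K hK [z z0 <-]]|x nx]; first exact: phi_DRCplus.
exists (polar x).1; first exact: polar_SDH.
by exists (polar x).2; [exact: polar_DRCplus | exact: phi_polar].
Qed.

Lemma ImH_direction (R : realType) (v : quat R) : ImH v ->
  exists u r, [/\ ImH u, qdot u u = 1 & v = r *: u].
Proof.
move=> vI; have [->|/eqP v0] := eqVneq v 0.
  (* the zero vector has no direction of its own: any unit does *)
  exists (qi R), 0; rewrite scale0r; split=> //.
  by rewrite /qdot /= !mulr0 mulr1 !(add0r, addr0).
exists ((Num.sqrt (qdot v v))^-1 *: v), (Num.sqrt (qdot v v)).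
split; [exact: ImHZ | exact: qnormalized |].
by rewrite scalerA mulfV ?scale1r // lt0r_neq0 // qnorm_gt0.
Qed.

(** An element of R + eps H has a direction only in its dual part w = r u; it
    lies in the slice of u, with b1 = 0 and b2 = r. *)
Lemma bigcup_DC (R : realType) : \bigcup_(K in SDH R) DC K = [set: DH R].
Proof.
rewrite -subTset => x _.
have [/R_epsHP x1|nx] := pselect (R_epsH R x); last first.
  exists (polar x).1; first exact: polar_SDH.
  by exists (polar x).2 => //; exact: phi_polar.
have [u [r [u0 n x2]]] := ImH_direction (ImH_qvec (dpart2 x)).
exists (Dual u 0).
  by apply/SDHP; split; rewrite //= /qdot /= !mul0r !addr0.
exists (Cplx (Dual (q0 (dpart1 x) : R^o) (q0 (dpart2 x) : R^o))
             (Dual 0 (r : R^o))) => //.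
rewrite phiE; apply: dualP; rewrite /= [RHS]qE ?x1 ?x2 !scale0r //.
by rewrite !addr0.
Qed.

Lemma image_Phi (R : realType) (A : set (DRC R)) :
  Phi R @` (SDH R `*` A) = \bigcup_(K in SDH R) phi K @` A.
Proof.
rewrite eqEsubset; split=> [_ [[K z] [/= hK Az] <-]|_ [K hK [z Az <-]]].
  by exists K => //; exists z.
by exists (K, z).
Qed.

Lemma CJE (R : realType) (J : DH R) : CJ J = phi J @` RC R.
Proof.
rewrite /CJ rspan2 eqEsubset; split=> x.
  case=> a [b ->].
  exists (Cplx (Dual (a : R^o) 0) (Dual (b : R^o) 0)); first exact/RCP.
  by rewrite phiE; apply: dualP => //=; rewrite !scale0r scaler0 !add0r.
case=> z /RCP[a0 b0] <-; exists (dpart1 (cpart1 z)), (dpart1 (cpart2 z)).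
by rewrite phiE a0 b0; apply: dualP => //=; rewrite !scale0r scaler0 !add0r.
Qed.

(** A non-real element of the cone has b1 <> 0; if b1 < 0, it is represented
    with a positive coefficient by the opposite unit. *)
Lemma bigcup_CJplus (R : realType) :
  \bigcup_(K in SDH R) CJplus K = QDH R `\` R_in_DH R.
Proof.
rewrite eqEsubset; split=> x.
  case=> K hK [z zp <-]; have /RCplusP[b0 a2 b2] := zp; split.
    by exists K; rewrite // CJE; exists z => //; exact/RCP.
  case=> r _ e; apply: (phi_DRCplus hK (sub_RCplus zp)); rewrite -e.
  by exists r => //; exists 0; rewrite //; apply: dualP; rewrite //= scaler0.
case=> -[K hK]; rewrite CJE => -[z /RCP[a2 b2] <-] nr.
have : dpart1 (cpart2 z) != 0.
  apply/eqP => b0; apply: nr; exists (dpart1 (cpart1 z)) => //.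
  by rewrite phiE b0 a2 b2; apply: dualP; rewrite /= !scale0r ?scaler0 !addr0.
rewrite neq_lt => /orP[b0|b0]; last first.
  by exists K => //; exists z => //; exact/RCplusP.
exists (- K); first exact: SDHN.
exists (cconj z); last exact: phiN.
by apply/RCplusP; rewrite /= oppr_gt0 b2 oppr0.
Qed.

(** * Fibres of Phi *)

Lemma fiber_nonreal (R : realType) (K : DH R) (a b : DR R) : SDH R K ->
  0 < dpart1 b ->
  Phi_fiber (phi K (Cplx a b)) = [set (K, Cplx a b); (- K, Cplx a (- b))].
Proof.
move=> hK b0; rewrite eqEsubset; split=> -[L w].
  case=> -[hL _] /esym /(phi_eq_nonreal (z := Cplx a b) hK hL (lt0r_neq0 b0)).
  by case=> -[/= -> ->]; [left|right].
case=> [[-> ->]|[-> ->]]; first by [].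
by split; [split=> //; exact: SDHN | exact: (phiN K (Cplx a b))].
Qed.

Lemma fiber_infinitesimal (R : realType) (K : DH R) (a : DR R) (b2 : R) :
  SDH R K -> b2 != 0 ->
  Phi_fiber (phi K (Cplx a (Dual 0 (b2 : R^o)))) =
  (TJ (dpart1 K) `*` [set Cplx a (Dual 0 (b2 : R^o))]) `|`
  (TJ (- dpart1 K) `*` [set Cplx a (- Dual 0 (b2 : R^o))]).
Proof.
move=> hK b20; rewrite eqEsubset; split=> -[L w].
  case=> -[hL _] /esym.
  move/(phi_eq_infinitesimal (z := Cplx a (Dual 0 b2)) hK hL erefl b20).
  case=> -[L1 /= ->]; [left|right]; split=> //=; first exact/TJP.
  exact/(TJP _ (SDHN hK)).
case=> -[] /=.
  move=> /(TJP _ hK)[hL L1] ->; split=> //.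
  by rewrite /Phi /= !phiE /= L1 !scale0r.
move=> /(TJP _ (SDHN hK))[hL L1] ->; split=> //.
by rewrite /Phi /= !phiE /= L1 oppr0 !scale0r scaleNr scalerN opprK.
Qed.

(** For b = 0 the value of phi does not depend on the unit, and phi is injective
    once the unit is fixed. *)
Lemma fiber_real (R : realType) (a : DR R) :
  Phi_fiber (DH_of_DR a) = SDH R `*` [set Cplx a 0].
Proof.
have aE (J : DH R) : DH_of_DR a = phi J (Cplx a 0).
  by rewrite phiE; apply: dualP; rewrite /= !scale0r ?addr0.
rewrite eqEsubset; split=> -[L w]; last first.
  by case=> /= hL ->; split=> //; rewrite /Phi /= -aE.
by case=> -[hL _]; rewrite (aE L) => /esym /(phi_injr hL) /= <-.
Qed.

(** * Coordinatewise convergence *)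

(** Stated for an arbitrary filter, so that it composes with the limit laws for
    sums, products and inverses. *)
Lemma cvg_to_initial (S : choiceType) (T : topologicalType) (f : S -> T)
    (X : Type) (F : set_system X) {FF : Filter F} (h : X -> S) (s : S) :
  f (h x) @[x --> F] --> f s -> h @ F --> (s : initial_topology f).
Proof.
move=> hs A [B [[C Cop <-] Cs CA]].
have /hs : nbhs (f s) C by exact: open_nbhs_nbhs.
by apply: (@filterS _ F FF _ (h @^-1` A)) => x; exact: CA.
Qed.

Lemma cvg_quat (R : topologicalType) (X : Type) (F : set_system X)
    {FF : Filter F} (h : X -> quat R) (l : quat R) :
  q0 (h x) @[x --> F] --> q0 l -> q1 (h x) @[x --> F] --> q1 l ->
  q2 (h x) @[x --> F] --> q2 l -> q3 (h x) @[x --> F] --> q3 l ->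
  h @ F --> l.
Proof.
move=> h0 h1 h2 h3; apply: (@cvg_to_initial _ _ (@tuple_of_quat R)).
exact: (cvg_pair (cvg_pair (cvg_pair h0 h1) h2) h3).
Qed.

Lemma cvg_dual (A : topologicalType) (X : Type) (F : set_system X)
    {FF : Filter F} (h : X -> dual A) (l : dual A) :
  dpart1 (h x) @[x --> F] --> dpart1 l ->
  dpart2 (h x) @[x --> F] --> dpart2 l -> h @ F --> l.
Proof.
move=> h1 h2; apply: (@cvg_to_initial _ _ (@pair_of_dual A)).
exact: (cvg_pair h1 h2).
Qed.

Lemma cvg_cplx (A : topologicalType) (X : Type) (F : set_system X)
    {FF : Filter F} (h : X -> cplx A) (l : cplx A) :
  cpart1 (h x) @[x --> F] --> cpart1 l ->
  cpart2 (h x) @[x --> F] --> cpart2 l -> h @ F --> l.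
Proof.
move=> h1 h2; apply: (@cvg_to_initial _ _ (@pair_of_cplx A)).
exact: (cvg_pair h1 h2).
Qed.

Lemma pair_coord_cvg (A B : topologicalType) (X : Type) (F : set_system X)
    {FF : Filter F} (h : X -> A * B) (l : A * B) : h @ F --> l ->
  (h x).1 @[x --> F] --> l.1 /\ (h x).2 @[x --> F] --> l.2.
Proof.
move=> hl.
by split; apply: (cvg_comp _ _ hl); [exact: cvg_fst | exact: cvg_snd].
Qed.

Lemma dual_coord_cvg (A : topologicalType) (X : Type) (F : set_system X)
    {FF : Filter F} (h : X -> dual A) (l : dual A) : h @ F --> l ->
  dpart1 (h x) @[x --> F] --> dpart1 l /\
  dpart2 (h x) @[x --> F] --> dpart2 l.
Proof.
move=> hl.
have t : pair_of_dual (h x) @[x --> F] --> pair_of_dual l.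
  exact: (cvg_comp _ _ hl (@initial_continuous _ _ (@pair_of_dual A) l)).
exact: (pair_coord_cvg t).
Qed.

Lemma cplx_coord_cvg (A : topologicalType) (X : Type) (F : set_system X)
    {FF : Filter F} (h : X -> cplx A) (l : cplx A) : h @ F --> l ->
  cpart1 (h x) @[x --> F] --> cpart1 l /\
  cpart2 (h x) @[x --> F] --> cpart2 l.
Proof.
move=> hl.
have t : pair_of_cplx (h x) @[x --> F] --> pair_of_cplx l.
  exact: (cvg_comp _ _ hl (@initial_continuous _ _ (@pair_of_cplx A) l)).
exact: (pair_coord_cvg t).
Qed.

Lemma quat_coord_cvg (R : topologicalType) (X : Type) (F : set_system X)
    {FF : Filter F} (h : X -> quat R) (l : quat R) : h @ F --> l ->
  [/\ q0 (h x) @[x --> F] --> q0 l, q1 (h x) @[x --> F] --> q1 l,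
      q2 (h x) @[x --> F] --> q2 l & q3 (h x) @[x --> F] --> q3 l].
Proof.
move=> hl.
have t : tuple_of_quat (h x) @[x --> F] --> tuple_of_quat l.
  exact: (cvg_comp _ _ hl (@initial_continuous _ _ (@tuple_of_quat R) l)).
have [t012 t3] := pair_coord_cvg t.
have [t01 t2] := pair_coord_cvg t012.
by have [t0 t1] := pair_coord_cvg t01.
Qed.

Lemma cvg_quatD (R : realType) (X : Type) (F : set_system X)
    {FF : Filter F} (g h : X -> quat R) (k l : quat R) :
  g @ F --> k -> h @ F --> l -> g x + h x @[x --> F] --> k + l.
Proof.
move=> /quat_coord_cvg[? ? ? ?] /quat_coord_cvg[? ? ? ?].
by apply: cvg_quat; exact: cvgD.
Qed.

Lemma cvg_quatB (R : realType) (X : Type) (F : set_system X)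
    {FF : Filter F} (g h : X -> quat R) (k l : quat R) :
  g @ F --> k -> h @ F --> l -> g x - h x @[x --> F] --> k - l.
Proof.
move=> /quat_coord_cvg[? ? ? ?] /quat_coord_cvg[? ? ? ?].
by apply: cvg_quat; exact: cvgB.
Qed.

Lemma cvg_quatZ (R : realType) (X : Type) (F : set_system X)
    {FF : Filter F} (g : X -> R) (h : X -> quat R) (k : R) (l : quat R) :
  g @ F --> k -> h @ F --> l -> g x *: h x @[x --> F] --> k *: l.
Proof.
by move=> ? /quat_coord_cvg[? ? ? ?]; apply: cvg_quat; exact: cvgM.
Qed.

Lemma cvg_qreal (R : realType) (X : Type) (F : set_system X)
    {FF : Filter F} (g : X -> R) (k : R) :
  g @ F --> k -> (g x)%:A @[x --> F] --> (k%:A : quat R).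
Proof. by move=> gk; apply: cvg_quatZ => //; exact: cvg_cst. Qed.

Lemma cvg_qvec (R : realType) (X : Type) (F : set_system X)
    {FF : Filter F} (h : X -> quat R) (l : quat R) :
  h @ F --> l -> qvec (h x) @[x --> F] --> qvec l.
Proof.
by move=> /quat_coord_cvg[? ? ? ?]; apply: cvg_quat => //=; exact: cvg_cst.
Qed.

Lemma cvg_qdot (R : realType) (X : Type) (F : set_system X)
    {FF : Filter F} (g h : X -> quat R) (k l : quat R) :
  g @ F --> k -> h @ F --> l -> qdot (g x) (h x) @[x --> F] --> qdot k l.
Proof.
move=> /quat_coord_cvg[? ? ? ?] /quat_coord_cvg[? ? ? ?].
by rewrite /qdot; do 3?[apply: cvgD]; exact: cvgM.
Qed.

(** * The homeomorphisms *)

Lemma Phi_continuous (R : realType) : continuous (Phi R).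
Proof.
move=> p; rewrite (funext (fun x => phiE x.1 x.2) : Phi R = _).
have [J1 J2] :
  dpart1 x.1 @[x --> p] --> dpart1 p.1 /\ dpart2 x.1 @[x --> p] --> dpart2 p.1.
  by apply: dual_coord_cvg; exact: cvg_fst.
have [z1 z2] :
  cpart1 x.2 @[x --> p] --> cpart1 p.2 /\ cpart2 x.2 @[x --> p] --> cpart2 p.2.
  by apply: cplx_coord_cvg; exact: cvg_snd.
have [a1 a2] := dual_coord_cvg z1.
have [b1 b2] := dual_coord_cvg z2.
apply: cvg_dual => /=; apply: cvg_quatD; do ?exact: cvg_qreal.
  exact: cvg_quatZ.
by apply: cvg_quatD; exact: cvg_quatZ.
Qed.

(** The square root is continuous on the whole line, and the formula divides
    only by r, which vanishes exactly on R + eps H. *)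
Lemma polar_continuous (R : realType) (x : DH R) :
  ~ R_epsH R x -> {for x, continuous (@polar R)}.
Proof.
move=> /R_epsHP x0; have r0 := lt0r_neq0 (qnorm_gt0 x0).
rewrite /prop_for /continuous_at.
have [x1 x2] :
    dpart1 y @[y --> x] --> dpart1 x /\ dpart2 y @[y --> x] --> dpart2 x.
  by have := @dual_coord_cvg _ _ _ (nbhs_filter x) id x; apply; exact: cvg_id.
have v : qvec (dpart1 y) @[y --> x] --> qvec (dpart1 x) by exact (cvg_qvec x1).
have w : qvec (dpart2 y) @[y --> x] --> qvec (dpart2 x) by exact (cvg_qvec x2).
pose r (y : DH R) := Num.sqrt (qdot (qvec (dpart1 y)) (qvec (dpart1 y))).
have rx : r y @[y --> x] --> r x.
  exact (continuous_cvg _ (@sqrt_continuous R _) (cvg_qdot v v)).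
have rVx : (r y)^-1 @[y --> x] --> (r x)^-1 by exact (cvgV r0 rx).
pose u (y : DH R) := (r y)^-1 *: qvec (dpart1 y).
have ux : u y @[y --> x] --> u x by exact (cvg_quatZ rVx v).
have s :
    qdot (qvec (dpart2 y)) (u y) @[y --> x] --> qdot (qvec (dpart2 x)) (u x).
  exact (cvg_qdot w ux).
have [[a1 _ _ _] [a2 _ _ _]] := (quat_coord_cvg x1, quat_coord_cvg x2).
exact (cvg_pair
  (cvg_dual (h := fun y => (polar y).1) (l := (polar x).1)
    ux (cvg_quatZ rVx (cvg_quatB w (cvg_quatZ s ux))))
  (cvg_cplx (h := fun y => (polar y).2) (l := (polar x).2)
    (cvg_dual (h := fun y => cpart1 (polar y).2) (l := cpart1 (polar x).2)
      a1 a2)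
    (cvg_dual (h := fun y => cpart2 (polar y).2) (l := cpart2 (polar x).2)
      rx s))).
Qed.

(** Both homeomorphisms are instances: on any set A of points with b1 > 0, Phi
    is injective and [polar] is a continuous inverse. *)
Lemma homeomorphism_on_Phi (R : realType) (A : set (DRC R))
    (B : DH R -> set (DH R)) :
  A `<=` DRCplus R -> (forall K, B K = phi K @` A) ->
  homeomorphism_on (SDH R `*` A) (\bigcup_(K in SDH R) B K) (Phi R).
Proof.
move=> Aplus BE; split.
- split.
  + by move=> [K z] [/= hK Az]; exists K => //; rewrite BE; exists z.
  + move=> [J z] [K w] /set_mem[/= hJ Az] /set_mem[/= hK Aw].
    by apply: phi_inj_DRCplus => //; exact: Aplus.
  + by move=> x [K hK]; rewrite BE => -[z Az <-]; exists (K, z).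
- exact/continuous_subspaceT/Phi_continuous.
- exists (@polar R).
    by move=> [J z] /set_mem[/= hJ /Aplus Az]; exact: polarK.
  apply: continuous_in_subspaceT => x /set_mem[K hK].
  rewrite BE => -[z /Aplus Az <-]; apply: polar_continuous.
  exact: phi_DRCplus.
Qed.

(** * Slices of the dual quaternions and fibres of Phi *)

Theorem proposition3p2 (R : realType) (I J : DH R)
    (hI : SDH R I) (hJ : SDH R J) :
  [/\ @star_subalgebra R (DH R) (dhconj R) (DC J),
      @star_isomorphic_to_sub R (DRC R) (DH R) (drcconj R) (dhconj R) (DC J),
      SDH R (dhi R),
      @star_subalgebra R (DH R) (dhconj R) (DC (dhi R)) /\
      @star_isomorphic_to_sub R (DRC R) (DH R) (drcconj R) (dhconj R)
        (DC (dhi R)) &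
      DC (dhi R) = dual_complex R]
  /\
  [/\ (I = J \/ I = - J -> DC I = DC J),
      (~ (I = J \/ I = - J) ->
         dpart1 I = dpart1 J \/ dpart1 I = - dpart1 J ->
         [/\ DR_in_DH R `<=` DC I `&` DC J,
             DC I `&` DC J =
               rspan [:: 1; dheps R; dheps R * Dual (dpart1 I) 0] &
             rspan [:: 1; dheps R; dheps R * Dual (dpart1 I) 0]
               `<=` R_epsH R]),
      (~ (dpart1 I = dpart1 J \/ dpart1 I = - dpart1 J) ->
         DR_in_DH R = DC I `&` DC J /\ DC I `&` DC J `<=` R_epsH R) &
      (I <> J -> DCplus I `&` DCplus J = set0)]
  /\
  [/\ [set: DH R] = \bigcup_(K in SDH R) DC K,
      Phi R @` (SDH R `*` setT) = setT &
      Phi R @` (SDH R `*` RC R) = QDH R]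
  /\
  (forall (K : DH R) (a : DR R), SDH R K ->
     [/\ (forall b : DR R, 0 < dpart1 b ->
            Phi_fiber (DH_of_DR a + K * DH_of_DR b) =
            [set (K, Cplx a b); (- K, Cplx a (- b))]),
         (forall b2 : R, b2 != 0 ->
            Phi_fiber (DH_of_DR a + K * (dheps R * b2%:A)) =
            (TJ (dpart1 K) `*` [set Cplx a (Dual 0 b2)]) `|`
            (TJ (- dpart1 K) `*` [set Cplx a (- Dual 0 b2)])) &
         Phi_fiber (DH_of_DR a) = SDH R `*` [set Cplx a 0]])
  /\
  [/\ homeomorphism_on (SDH R `*` DRCplus R)
        (\bigcup_(K in SDH R) DCplus K) (Phi R),
      \bigcup_(K in SDH R) DCplus K = ~` R_epsH R,
      homeomorphism_on (SDH R `*` RCplus R)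
        (\bigcup_(K in SDH R) CJplus K) (Phi R) &
      \bigcup_(K in SDH R) CJplus K = QDH R `\` R_in_DH R].
Proof.
split; [|split; [|split; [|split]]].
- split.
  + exact: DC_star_subalgebra.
  + exact: DC_star_isomorphic.
  + exact: SDH_i.
  + split; [apply: DC_star_subalgebra | apply: DC_star_isomorphic];
      exact: SDH_i.
  + exact: DC_i.
- split.
  + by case=> ->; rewrite ?DCN.
  + move=> neIJ I1; split.
    * by move=> x Rx; split; exact: DR_sub_DC.
    * exact: DCI_same_tangent.
    * rewrite rspan_1_eps_epsJ => _ [a1 [a2 [b2 ->]]].
      by exists a1 => //; exists (a2%:A + b2 *: dpart1 I).
  + move=> I1; rewrite DCI_transverse //; split=> //.
    exact: DR_sub_R_epsH.
  + exact: DCplusI.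
- split.
  + by rewrite bigcup_DC.
  + by rewrite image_Phi -bigcup_DC.
  + by rewrite image_Phi; apply: eq_bigcupr => K _; rewrite CJE.
- move=> K a hK; split.
  + by move=> b b0; exact: fiber_nonreal.
  + move=> b2 b20; rewrite -(fiber_infinitesimal a hK b20).
    (* eps b2 is a real dual number, so that the point is a value of phi *)
    congr (Phi_fiber (_ + K * _)).
    by apply: dualP; rewrite /= ?mul0r ?mul1r ?scale0r ?scaler0 ?addr0 ?add0r.
  + exact: fiber_real.
- split.
  + exact: homeomorphism_on_Phi.
  + exact: bigcup_DCplus.
  + apply: homeomorphism_on_Phi => //; exact: sub_RCplus.
  + exact: bigcup_CJplus.
Qed.
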